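(* For every positive integer $n$, the number of gap-free partitions of $n$ with at least two distinct part values equals the sum of the smallest parts of the partitions of $n$ into distinct parts with an even number of parts: \[ \left|\mathcal{G}(n)\setminus\mathcal{G}^0(n)\right|=\sum_{\lambda\in\mathcal{D_E}(n)}s(\lambda). \]
   Context: A partition is gap-free if its distinct part values are consecutive integers. $\mathcal{G}(n)$ is the set of gap-free partitions of $n$; $\mathcal{G}^0(n)$ is the set of partitions of $n$ having exactly one distinct part value. $\mathcal{D_E}(n)$ is the set of partitions of $n$ into distinct parts with an even number of parts, and $s(\lambda)$ denotes the smallest part of $\lambda$. *)

(* Defs.v *)
From HB Require Import structures.
From mathcomp Require Import all_boot.

Set Implicit Arguments.
Unset Strict Implicit.
Unset Printing Implicit Defensive.

(* A partition of n is the weakly decreasing sequence of its positive parts. *)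
Definition is_partition (n : nat) (s : seq nat) : bool :=
  [&& sorted geq s, 0 \notin s & sumn s == n].

Record intpart (n : nat) := IntPart {
  parts :> seq nat;
  partsP : is_partition n parts
}.

HB.instance Definition _ (n : nat) := [isSub for @parts n].
HB.instance Definition _ (n : nat) := [Countable of intpart n by <:].

Section IntPartFinite.
Variable n : nat.

Lemma leq_sumn_mem (s : seq nat) (k : nat) : k \in s -> k <= sumn s.
Proof.
elim: s => //= a s IHs; rewrite inE => /orP[/eqP-> | /IHs le_ks].
  exact: leq_addr.
exact: leq_trans le_ks (leq_addl _ _).
Qed.

Lemma leq_size_sumn (s : seq nat) : 0 \notin s -> size s <= sumn s.
Proof.
elim: s => //= a s IHs; rewrite inE negb_or eq_sym -lt0n => /andP[a_gt0 s_n0].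
by rewrite -add1n leq_add ?IHs.
Qed.

Lemma intpart_part_leq (p : intpart n) (k : nat) : k \in parts p -> k <= n.
Proof. by case: p => s /= /and3P[_ _ /eqP<-]; apply: leq_sumn_mem. Qed.

Lemma intpart_size_leq (p : intpart n) : size (parts p) <= n.
Proof. by case: p => s /= /and3P[_ s_n0 /eqP<-]; apply: leq_size_sumn. Qed.

Definition intpart_bseq (p : intpart n) : n.-bseq 'I_n.+1 :=
  insub_bseq n [seq inord k | k <- parts p].

Definition bseq_intpart (b : n.-bseq 'I_n.+1) : option (intpart n) :=
  insub [seq val i | i <- b].

Lemma intpart_bseqK : pcancel intpart_bseq bseq_intpart.
Proof.
move=> p; rewrite /bseq_intpart /intpart_bseq /insub_bseq val_insubd size_map.
rewrite intpart_size_leq -map_comp map_id_in ?(valK p) // => k /intpart_part_leq.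
by move=> le_kn; rewrite /= inordK.
Qed.

HB.instance Definition _ : isFinite (intpart n) := PCanIsFinite intpart_bseqK.

End IntPartFinite.

Definition part_values (s : seq nat) : seq nat := undup s.

(* The last entry, since parts are listed in weakly decreasing order; the
   default 0 is only reached by the empty partition of 0. *)
Definition smallest_part (s : seq nat) : nat := last 0 s.

(* The d distinct part values are m, m + 1, ..., m + d - 1, with m the smallest
   part. *)
Definition is_gap_free (s : seq nat) : bool :=
  perm_eq (part_values s) (iota (smallest_part s) (size (part_values s))).

Definition gap_free (n : nat) : {set intpart n} :=
  [set p : intpart n | is_gap_free p].

Definition one_part_value (n : nat) : {set intpart n} :=
  [set p : intpart n | size (part_values p) == 1].

Definition distinct_even (n : nat) : {set intpart n} :=
  [set p : intpart n | uniq p && ~~ odd (size p)].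

(* Main.v *)
(** Let p be a gap-free partition of n with L parts and smallest part m. The set
of positions i in [1, L-1] with p_i > p_(i+1), completed by 0 if needed to have
even size, is a set T of residues modulo L with sum(T) + m L = n. List the
elements of the periodic set T + L Z in increasing order, and slide the window
of size |T| that starts on T upwards by m places: each step replaces the
smallest element x by x + L, so the final window q consists of distinct parts
summing to n. The predecessor j of the window in T + L Z is max(q) - L; it
satisfies 0 <= j < min(q), and (q, j) determines L, then T and m. Hence p
corresponds to a partition q into an even number of distinct parts together
with one of s(q) choices for j. *)

Require Import Defs.
From mathcomp Require Import all_boot.
From mathcomp Require Import zify.

Set Implicit Arguments.
Unset Strict Implicit.
Unset Printing Implicit Defensive.

(** * Counting through a one-to-one relation *)

(** Lets a bijection be given as a relation, without writing either map. Each inequality comes from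
    a choice function, injective because the relation is. *)
Lemma card_correspondence (X Y : finType) (A : {set X}) (B : {set Y})
    (R : X -> Y -> Prop) :
    (forall x, x \in A -> exists2 y, y \in B & R x y) ->
    (forall y, y \in B -> exists2 x, x \in A & R x y) ->
    (forall x y y', R x y -> R x y' -> y = y') ->
    (forall x x' y, R x y -> R x' y -> x = x') ->
  #|A| = #|B|.
Proof.
have half (X' Y' : finType) (A' : {set X'}) (B' : {set Y'})
    (R' : X' -> Y' -> Prop) :
    (forall x, x \in A' -> exists2 y, y \in B' & R' x y) ->
    (forall x x' y, R' x y -> R' x' y -> x = x') -> #|A'| <= #|B'|.
  move=> tot inj.
  (* [R'] lives in [Prop], so the choice function is built along a list of elements. [option]
     supplies a value outside [A'], as [Y'] may be empty. *)
  have [f fP]: exists f : X' -> option Y', forall x, x \in A' ->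
      exists2 y, f x = Some y & y \in B' /\ R' x y.
    have: forall s : seq X', exists f : X' -> option Y', forall x, x \in s ->
        x \in A' -> exists2 y, f x = Some y & y \in B' /\ R' x y.
      elim=> [|x s [f IHf]]; first by exists (fun=> None).
      case: (boolP (x \in A')) => [/tot[y yB Rxy]|xA'].
        exists (fun z => if z == x then Some y else f z) => z.
        rewrite inE; case: eqP => [-> _ _|_ /= zs]; first by exists y.
        exact: IHf.
      exists f => z; rewrite inE => /orP[/eqP->|]; last exact: IHf.
      by rewrite (negPf xA').
    by case/(_ (enum X')) => f fP; exists f => x; apply: fP; rewrite mem_enum.
  have injf : {in A' &, injective f}.
    move=> x x' /fP[y -> [_ Rxy]] /fP[y' -> [_ Rxy']] [eqy].
    by apply: inj Rxy _; rewrite eqy.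
  have Some_inj : injective (@Some Y') by move=> y y' [].
  rewrite -(card_in_imset injf) -(card_imset (mem B') Some_inj).
  apply/subset_leq_card/subsetP => _ /imsetP[x /fP[y -> [yB _]] ->].
  exact: imset_f.
move=> totA totB funR injR; apply/eqP; rewrite eqn_leq.
by rewrite (half _ _ _ _ _ totA injR) (half _ _ _ _ (fun y x => R x y) totB) //
  => y y' x; apply: funR.
Qed.

(** * Windows of a periodic set and their shifts *)

(* Windows are listed in decreasing order. *)
Definition shift (L : nat) (c : seq nat) : seq nat :=
  if c is x :: s then last x s + L :: belast x s else [::].

(** The entries lie in an interval shorter than [L], so they are incongruent modulo [L]: consecutive
    elements of the periodic set they generate. *)
Definition window (L : nat) (c : seq nat) : bool :=
  [&& 0 < size c, sorted gtn c & head 0 c < last 0 c + L].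

Lemma shift_rcons L b x : shift L (rcons b x) = x + L :: b.
Proof. by case: b => [|y b] //=; rewrite last_rcons belast_rcons. Qed.

Lemma size_shift L c : size (shift L c) = size c.
Proof. by case: c => //= x s; rewrite size_belast. Qed.

Lemma shift_inj L : injective (shift L).
Proof.
move=> c c'; case/lastP: c => [|b x]; case/lastP: c' => [|b' x'] //;
  rewrite ?shift_rcons //.
by case=> /addIn-> ->.
Qed.

Lemma sorted_gtn_rcons b x :
  sorted gtn (rcons b x) = sorted gtn b && ((b == [::]) || (x < last 0 b)).
Proof. by case: b => [|y b] //=; rewrite rcons_path. Qed.

Lemma path_gtn_head x b :
  path gtn x b = sorted gtn b && ((b == [::]) || (head 0 b < x)).
Proof. by case: b => [|y b] //=; rewrite andbC. Qed.

(** The bound on the old head makes [x + L] the new maximum, and the strict decrease at the old end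
    gives the new bound. For a singleton the bound amounts to [0 < L]. *)
Lemma window_shift L c : window L c -> window L (shift L c).
Proof.
case/lastP: c => [|b x] //; rewrite shift_rcons /window size_rcons /=.
rewrite sorted_gtn_rcons path_gtn_head last_rcons.
by case: b => [|y b] /=; lia.
Qed.

Lemma sumn_shift L c : 0 < size c -> sumn (shift L c) = sumn c + L.
Proof. by case/lastP: c => [|b x] //; rewrite shift_rcons sumn_rcons /=; lia. Qed.

Lemma head_shift L c : 0 < size c -> L <= head 0 (shift L c).
Proof. by case/lastP: c => [|b x] // _; rewrite shift_rcons /= leq_addl. Qed.

Lemma size_iter_shift m L c : size (iter m (shift L) c) = size c.
Proof. by elim: m => //= m IHm; rewrite size_shift. Qed.

Lemma window_iter_shift m L c : window L c -> window L (iter m (shift L) c).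
Proof. by move=> wc; elim: m => //= m; apply: window_shift. Qed.

Lemma sumn_iter_shift m L c :
  0 < size c -> sumn (iter m (shift L) c) = sumn c + m * L.
Proof.
move=> c0; elim: m => [|m IHm] /=; first by rewrite addn0.
by rewrite sumn_shift ?size_iter_shift // IHm; lia.
Qed.

(** A shifted list has head at least [L], so neither start is itself a shift: undoing shifts on both
    sides stops at the same time. *)
Lemma iter_shift_inj m m' L T T' :
    0 < size T -> 0 < size T' -> head 0 T < L -> head 0 T' < L ->
  iter m (shift L) T = iter m' (shift L) T' -> m = m' /\ T = T'.
Proof.
move=> T0 T0' hT hT'; elim: m m' => [|m IHm] [|m'] //= eqT.
- by move: hT; rewrite eqT ltnNge head_shift ?size_iter_shift.
- by move: hT'; rewrite -eqT ltnNge head_shift ?size_iter_shift.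
- by case: (IHm m' (shift_inj eqT)) => -> ->.
Qed.

Lemma sorted_gtn_uniq T : sorted gtn T -> uniq T.
Proof. by rewrite gtn_sorted_uniq_geq => /andP[]. Qed.

Lemma sorted_geq_mem_le x s v : path geq x s -> v \in x :: s -> last x s <= v <= x.
Proof.
elim: s x v => [|y s IHs] x v /=; first by rewrite inE => _ /eqP->; rewrite leqnn.
case/andP=> yx sy; have /andP[ly _] := IHs y y sy (mem_head _ _).
rewrite inE => /orP[/eqP->|/(IHs _ _ sy)]; lia.
Qed.

Lemma window_gt0 L c : window L c -> 0 < L.
Proof.
case: c => // x s /and3P[_ sx /=].
move: sx; rewrite gtn_sorted_uniq_geq => /andP[_ /sorted_geq_mem_le].
by move/(_ _ (mem_head _ _)); lia.
Qed.

(** Shifts are undone as long as the head is at least [L]. Each undoing lowers the sum by [L > 0],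
    so the process ends. *)
Lemma window_iter_shiftP L c : window L c ->
  exists m T, [/\ window L T, head 0 T < L & c = iter m (shift L) T].
Proof.
have [k] := ubnP (sumn c); elim: k c => // k IHk c lek wc.
have [hc|hc] := ltnP (head 0 c) L; first by exists 0, c.
case: c wc lek hc => // y b wc lek /= hc.
have wb : window L (rcons b (y - L)).
  move: wc; rewrite /window size_rcons /= sorted_gtn_rcons path_gtn_head.
  by rewrite last_rcons; case: (b) => [|z b'] /=; lia.
have L0 := window_gt0 wc.
have [||m [T [wT hT eqb]]] := IHk (rcons b (y - L)) => //.
  by move: lek; rewrite sumn_rcons /=; lia.
exists m.+1, T; split=> //=.
by rewrite -eqb shift_rcons subnK.
Qed.

(** * Partitions with prescribed descent positions *)

(** For entries of [T] below [L], this is the conjugate of [T], padded with zeros to length [L] and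
    raised by [m]. An entry 0 of [T] leaves no trace, since positions start at 1. *)
Definition staircase (L m : nat) (T : seq nat) : seq nat :=
  [seq m + count (leq i) T | i <- iota 1 L].

Lemma size_staircase L m T : size (staircase L m T) = L.
Proof. by rewrite size_map size_iota. Qed.

Lemma nth_staircase L m T i :
  i < L -> nth 0 (staircase L m T) i = m + count (leq i.+1) T.
Proof. by move=> iL; rewrite (nth_map 0) ?size_iota // nth_iota. Qed.

Lemma sorted_gtn_lt_bound L T :
  sorted gtn T -> head 0 T < L -> all (gtn L) T.
Proof.
case: T => // x T sT /= xL; rewrite xL /=.
have /allP mn := order_path_min (rev_trans ltn_trans) sT.
by apply/allP => y /mn /=; lia.
Qed.

Lemma count_leq_all_gtn L T : all (gtn L) T -> count (leq L) T = 0.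
Proof. by elim: T => //= x T IHT /andP[xL /IHT->]; rewrite leqNgt xL. Qed.

Lemma last_staircase L m T :
  0 < L -> all (gtn L) T -> last 0 (staircase L m T) = m.
Proof.
move=> L0 aT; rewrite -nth_last size_staircase nth_staircase ?prednK //.
by rewrite count_leq_all_gtn ?addn0.
Qed.

Lemma head_staircase L m T :
  0 < L -> head 0 (staircase L m T) = m + count (leq 1) T.
Proof. by case: L. Qed.

Lemma sumn_staircase L m T :
  all (gtn L) T -> sumn (staircase L m T) = sumn T + m * L.
Proof.
have leqS t : t < L -> sumn [seq nat_of_bool (i <= t) | i <- iota 1 L] = t.
  move=> tL; rewrite sumn_count -[RHS](size_iota 1).
  rewrite -size_filter; congr size.
  apply: (irr_sorted_eq ltn_trans ltnn).
  - exact/(sorted_filter ltn_trans)/iota_ltn_sorted.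
  - exact: iota_ltn_sorted.
  by move=> i; rewrite mem_filter !mem_iota; lia.
elim: T => [|t T IHT] /=.
  move=> _; rewrite /staircase /= sumnE big_map.
  by rewrite big_const_seq count_predT size_iota iter_addn_0 addn0.
case/andP=> /leqS tL /IHT; rewrite /staircase !sumnE !big_map => IHT'.
rewrite -addnA -IHT' -[in RHS]tL sumnE big_map -big_split /=.
by apply: eq_bigr => i _; lia.
Qed.

Lemma count_leq_split T i :
  uniq T -> count (leq i) T = count (leq i.+1) T + (i \in T).
Proof.
elim: T => //= t T IHT /andP[tT /IHT->]; rewrite inE.
by case: eqP tT => [->|] /=; lia.
Qed.

(** Recovers [T] from its counts; for [1 <= i < L] the inequality is a descent of the staircase
    between positions [i] and [i + 1]. *)
Lemma mem_count_leq T i :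
  uniq T -> (i \in T) = (count (leq i.+1) T < count (leq i) T).
Proof.
by move/(count_leq_split i)->; case: (i \in T); lia.
Qed.

Lemma count_leq0 (T : seq nat) : count (leq 0) T = size T.
Proof. by apply/eqP; rewrite -all_count; apply/allP. Qed.

Lemma size_count_leq1 T : uniq T -> size T = count (leq 1) T + (0 \in T).
Proof. by rewrite -count_leq0 => /(count_leq_split 0). Qed.

(** The last part gives [m] and the descents give the nonzero elements of [T]. Whether 0 belongs to
    [T] is then decided by the parity of its size. *)
Lemma staircase_inj L m m' T T' :
    0 < L -> sorted gtn T -> sorted gtn T' -> head 0 T < L -> head 0 T' < L ->
    ~~ odd (size T) -> ~~ odd (size T') ->
  staircase L m T = staircase L m' T' -> m = m' /\ T = T'.
Proof.
move=> L0 sT sT' hT hT' eT eT' eqT.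
have aT := sorted_gtn_lt_bound sT hT; have aT' := sorted_gtn_lt_bound sT' hT'.
have eqm : m = m'.
  by rewrite -(last_staircase m L0 aT) -(last_staircase m' L0 aT') eqT.
split=> //; subst m'.
have eqc i : count (leq i.+1) T = count (leq i.+1) T'.
  have [iL|Li] := ltnP i L.
    by apply: (@addnI m); rewrite -!(nth_staircase _ _ iL) eqT.
  rewrite !count_leq_all_gtn //.
    by apply: sub_all aT' => t /=; lia.
  by apply: sub_all aT => t /=; lia.
have uT : uniq T by move: sT; rewrite gtn_sorted_uniq_geq => /andP[].
have uT' : uniq T' by move: sT'; rewrite gtn_sorted_uniq_geq => /andP[].
have eqs : size T = size T'.
  move: eT eT'; rewrite (size_count_leq1 uT) (size_count_leq1 uT') eqc !oddD.
  by case: (0 \in T); case: (0 \in T'); case: (odd _).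
apply: (irr_sorted_eq (rev_trans ltn_trans) ltnn) => // i.
rewrite !mem_count_leq // eqc; case: i => [|i]; last by rewrite eqc.
by rewrite !count_leq0 eqs.
Qed.

(** * Gap-free partitions as lists with steps 0 or 1 *)

Definition small_step (x y : nat) : bool := y <= x <= y.+1.

(** Prepending a part moves every descent position up by one, and a strict step adds position 1. *)
Lemma staircase_steps x s : path small_step x s ->
  exists T, [/\ sorted gtn T, 0 \notin T, all (gtn (size s).+1) T
    & x :: s = staircase (size s).+1 (last x s) T].
Proof.
elim: s x => [|y s IHs] x /=; first by exists [::]; rewrite /staircase /= addn0.
case/andP=> xy /IHs[T [sT T0 aT eqT]].
(* As 0 is not in [T], every entry counts at position 1. *)
have eqy : y = last y s + size T.
  apply: etrans (congr1 (head 0) eqT) _; rewrite head_staircase //.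
  congr (_ + _); apply/eqP; rewrite -all_count.
  by apply/allP => t tT; rewrite lt0n; apply: contraNneq T0 => <-.
have sS : sorted gtn (map S T) by rewrite sorted_map.
have S0 : all (fun t => 1 < t) (map S T).
  rewrite all_map; apply/allP => t tT /=.
  by rewrite ltnS lt0n; apply: contraNneq T0 => <-.
(* Common to both cases: [U] is [map S T], with or without a final 1, which counts from position 2
   on do not see. *)
have stepS U : (forall i, count (leq i.+2) U = count (leq i.+1) T) ->
    x = last y s + count (leq 1) U ->
    x :: y :: s = staircase (size s).+2 (last y s) U.
  move=> cU eqx; rewrite eqT {1}eqx /staircase.
  rewrite -[iota 1 (size s).+2]/(1 :: iota (1 + 1) (size s).+1) iotaDl /=.
  congr [:: _, _ & _]; first by rewrite -cU.
  rewrite -map_comp.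
  apply/eq_in_map => i; rewrite mem_iota => /andP[i0 _] /=.
  by case: i i0 => // i _; rewrite add1n cU.
have cS i : count (leq i.+2) (map S T) = count (leq i.+1) T by rewrite count_map.
have c1 : count (leq 1) (map S T) = size T.
  by rewrite count_map -[RHS]count_predT; apply: eq_count.
have [eqxy|nexy] := eqVneq x y.
  exists (map S T); split=> //.
  - by apply: contraTN S0 => ?; apply/allPn; exists 0.
  - by rewrite all_map; apply: sub_all aT => t.
  by apply: stepS => //; rewrite c1 eqxy.
exists (rcons (map S T) 1); split.
- rewrite sorted_gtn_rcons sS; case: (map S T) S0 => [|t U] // /allP gt1.
  exact: gt1 (mem_last t U).
- rewrite mem_rcons inE /=.
  by apply: contraTN S0 => ?; apply/allPn; exists 0.
- by rewrite all_rcons all_map; apply/andP; split=> //; apply: sub_all aT => t.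
apply: stepS => [i|]; rewrite -cats1 count_cat /= ?cS ?c1 //; first by lia.
by move: xy nexy; rewrite /small_step; lia.
Qed.

Lemma small_step_geq x s : path small_step x s -> path geq x s.
Proof. by apply: sub_path => y z /andP[]. Qed.

Lemma small_step_interval x s :
  path small_step x s -> x :: s =i iota (last x s) (x - last x s).+1.
Proof.
move=> st v; rewrite mem_iota; have sx := small_step_geq st.
have /andP[lx _] := sorted_geq_mem_le sx (mem_head _ _).
rewrite addnS ltnS subnKC //.
apply/idP/idP => [/(sorted_geq_mem_le sx)//|].
elim: s x st {sx lx} => [|y s IHs] x /=; first by rewrite inE; lia.
case/andP=> xy /IHs IH /andP[lv vx]; rewrite inE; case: eqP => //= nvx.
by apply: IH; move: xy; rewrite /small_step; lia.
Qed.

(** A drop of at least 2 down to [y] would skip the value [y.+1]; conversely, steps of at most 1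
    meet every value between the extremes. *)
Lemma gap_freeP x s : path geq x s ->
  reflect (path small_step x s) (is_gap_free (x :: s)).
Proof.
move=> sx; apply: (iffP idP) => [gf|st].
  have full v : last x s <= v <= x -> v \in x :: s.
    case/andP=> lv vx; have := perm_mem gf; rewrite /smallest_part /part_values.
    (* Gap-freeness fixes the interval by its length only; membership of [x] itself shows that it
       reaches up to [x]. *)
    rewrite [last 0 _]/= => mem; have := mem x; have := mem v.
    rewrite !mem_undup !mem_iota mem_head => -> /esym/andP[_ ltx].
    by rewrite lv (leq_ltn_trans vx ltx).
  elim: s x sx full {gf} => [|y s IHs] x //= /andP[yx sy] full.
  have /andP[ly _] := sorted_geq_mem_le sy (mem_head _ _).
  rewrite IHs ?andbT // => [|v /andP[lv vy]].
    rewrite /small_step yx leqNgt; apply/negP => lt_x.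
    have: y.+1 \in x :: y :: s by apply: full; lia.
    by rewrite inE => /orP[|/(sorted_geq_mem_le sy)]; lia.
  have: v \in x :: y :: s by apply: full; lia.
  by rewrite inE => /orP[/eqP eqv|//]; rewrite inE; lia.
rewrite /is_gap_free /part_values /smallest_part [last 0 _]/=.
have pe : perm_eq (undup (x :: s)) (iota (last x s) (x - last x s).+1).
  apply: uniq_perm; rewrite ?undup_uniq ?iota_uniq // => v.
  by rewrite mem_undup small_step_interval.
by rewrite (perm_size pe) size_iota.
Qed.

Lemma size_part_values x s : path small_step x s ->
  size (part_values (x :: s)) = (x - last x s).+1.
Proof.
move=> st; rewrite -(size_iota (last x s) (x - last x s).+1).
apply/perm_size/uniq_perm; rewrite ?undup_uniq ?iota_uniq // => v.
by rewrite mem_undup small_step_interval.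
Qed.

Lemma small_step_staircase L m T :
  uniq T -> sorted small_step (staircase L m T).
Proof.
move=> uT; apply/(sortedP 0) => i; rewrite size_staircase => iL.
rewrite !nth_staircase //; last by lia.
rewrite (count_leq_split _ uT).
by rewrite /small_step; case: (_ \in T); lia.
Qed.

Lemma last_gt0_notin s : sorted geq s -> 0 < last 0 s -> 0 \notin s.
Proof.
case: s => // x s sx /= l0; apply: contraL l0 => /(sorted_geq_mem_le sx).
by rewrite leqn0 lt0n => /andP[->].
Qed.

(** * The correspondence and the count *)

(** Here [j] is the predecessor of the window [q] in the periodic set. The additive form avoids
    truncated subtraction and lets [(q, j)] determine [L]. *)
Definition encodes (L m : nat) (T p q : seq nat) (j : nat) : Prop :=
  [/\ window L T, head 0 T < L, ~~ odd (size T), p = staircase L m T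
    & q = iter m (shift L) T /\ head 0 q = j + L].

Lemma gap_free_encodes n p :
    0 < n -> is_partition n p -> is_gap_free p -> size (part_values p) != 1 ->
  exists L m T, [/\ 0 < m, window L T, head 0 T < L, ~~ odd (size T)
    & p = staircase L m T].
Proof.
case: p => [|x s] n0 /and3P[sp p0 /eqP sumn_p]; first by rewrite -sumn_p in n0.
move/(gap_freeP sp) => st; rewrite size_part_values // => nx.
have [T [sT T0 aT eqT]] := staircase_steps st.
(* The number of parts, the smallest part, and the descent positions completed by 0 to even size. *)
exists (size s).+1, (last x s), (if odd (size T) then rcons T 0 else T).
(* Without a descent all parts would be equal, which [nx] excludes. *)
have sizeT : 0 < size T.
  rewrite lt0n; apply: contraNneq nx => /size0nil T_nil.
  by have := congr1 (head 0) eqT; rewrite head_staircase // T_nil /=; lia.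
have m0 : 0 < last x s.
  by rewrite lt0n; apply: contraNneq p0 => <-; apply: mem_last.
have hT : head 0 T < (size s).+1 by case: (T) sizeT aT => //= t U _ /andP[].
case: ifP => oT; last first.
  split=> //; rewrite ?oT // /window sizeT sT; apply: leq_trans hT (leq_addl _ _).
have sT0 : sorted gtn (rcons T 0).
  rewrite sorted_gtn_rcons sT; case: (T) T0 => [|t U] //= T0.
  by rewrite lt0n; apply: contraNneq T0 => <-; apply: mem_last.
have hT0 : head 0 (rcons T 0) < (size s).+1 by case: (T) sizeT hT.
split=> //; rewrite ?size_rcons /= ?oT //.
  by rewrite /window size_rcons sT0 last_rcons.
rewrite eqT; apply/eq_in_map => i; rewrite mem_iota -cats1 count_cat /=.
by case: i => //= i _; rewrite !addn0.
Qed.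

Lemma staircase_gap_free n L m T :
    0 < m -> window L T -> head 0 T < L -> ~~ odd (size T) ->
    sumn T + m * L = n ->
  [/\ is_partition n (staircase L m T), is_gap_free (staircase L m T)
    & size (part_values (staircase L m T)) != 1].
Proof.
move=> m0 /and3P[T0 sT _] hT eT sumT.
have L0 : 0 < L by apply: leq_ltn_trans hT.
have aT := sorted_gtn_lt_bound sT hT; have uT := sorted_gtn_uniq sT.
have := small_step_staircase L m uT; have := last_staircase m L0 aT.
have := head_staircase m T L0; have := sumn_staircase m aT.
case: (staircase L m T) => [|x s]; first by move=> _ _ /= m_eq0; rewrite -m_eq0 in m0.
move=> /= sumn_p hp lp st; have sx := small_step_geq st; split.
- rewrite /is_partition /= sx last_gt0_notin /= ?lp //=.
  by rewrite sumn_p sumT.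
- exact/(gap_freeP sx).
rewrite size_part_values // lp hp addKn.
(* A nonempty [T] of even size has at least two elements, so one is nonzero and gives a descent. *)
have := size_count_leq1 uT; case: (0 \in T); move: T0 eT;
  case: (size T) => [|[|k]] //; lia.
Qed.

Theorem theorem5p5 (n : nat) (n_gt0 : 0 < n) :
  #|gap_free n :\: one_part_value n|
    = \sum_(p in distinct_even n) smallest_part p.
Proof.
(* The sum of smallest parts counts pairs [(q, j)] with [j] below the smallest part of [q]; ['I_n]
   is large enough by [le_last]. *)
pose B := [set x : intpart n * 'I_n |
  (x.1 \in distinct_even n) && (x.2 < smallest_part x.1)].
have le_last (q : intpart n) : smallest_part q <= n.
  case: q => q /= /and3P[_ _ /eqP <-]; rewrite /smallest_part.
  by case: q => //= x s; have := leq_sumn_mem (mem_last x s).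
transitivity #|B|; last first.
  rewrite -sum1dep_card -(pair_big_dep (mem (distinct_even n))
    (fun p (j : 'I_n) => j < smallest_part p) (fun _ _ => 1)) /=.
  apply: eq_bigr => q _.
  by rewrite -(big_ord_widen n (fun=> 1)) ?le_last // sum1_card card_ord.
apply: (@card_correspondence _ _ _ _
  (fun (p : intpart n) (x : intpart n * 'I_n) =>
    exists L m T, encodes L m T p x.1 x.2)).
- case=> p pP; rewrite !inE /= => /andP[pv gf].
  have [L [m [T [m0 wT hT eT eqp]]]] := gap_free_encodes n_gt0 pP gf pv.
  set q := iter m (shift L) T.
  have wq : window L q by apply: window_iter_shift.
  have T0 : 0 < size T by case/and3P: wT.
  (* As [m > 0], at least one shift took place, so [head 0 q - L] is not truncated. *)
  have hq : L <= head 0 q.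
    by rewrite /q -(prednK m0) /= head_shift // size_iter_shift.
  have [q0 sq lq] := and3P wq.
  have jl : head 0 q - L < last 0 q by lia.
  have /andP[uq gq] : uniq q && sorted geq q by rewrite -gtn_sorted_uniq_geq.
  have qP : is_partition n q.
    rewrite /is_partition gq last_gt0_notin //=; last by lia.
    have [_ sT _] := and3P wT.
    rewrite sumn_iter_shift // -(sumn_staircase m (sorted_gtn_lt_bound sT hT)).
    by rewrite -eqp; case/and3P: pP.
  have jn : head 0 q - L < n by apply: leq_trans jl (le_last (IntPart qP)).
  exists (IntPart qP, Ordinal jn).
    by rewrite !inE /= uq size_iter_shift eT.
  by exists L, m, T; split=> //=; rewrite subnK.
- case=> [[q qP] j]; rewrite !inE /= /smallest_part => /andP[/andP[uq eq] jl].
  have [gq _ /eqP sumn_q] := and3P qP.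
  have sq : sorted gtn q by rewrite gtn_sorted_uniq_geq uq.
  have lh : last 0 q <= head 0 q.
    case: (q) gq jl => //= x s sx _.
    by case/andP: (sorted_geq_mem_le sx (mem_head _ _)).
  (* With this [L], the window bound is exactly [j < last 0 q]. An empty [q] has default smallest
     part 0 and admits no [j]. *)
  have wq : window (head 0 q - j) q.
    by rewrite /window sq; case: (q) jl lh => //= x s; lia.
  have [m [T [wT hT eqq]]] := window_iter_shiftP wq.
  have T0 : 0 < size T by case/and3P: wT.
  (* With no shift, [head 0 q] would be below [head 0 q - j]. *)
  have m0 : 0 < m.
    by case: m eqq => //= eqq; move: hT; rewrite -eqq; move: jl lh; lia.
  have eT : ~~ odd (size T) by rewrite -(size_iter_shift m (head 0 q - j)) -eqq.
  have sumT : sumn T + m * (head 0 q - j) = n.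
    by rewrite -sumn_iter_shift // -eqq.
  have [pP gf pv] := staircase_gap_free m0 wT hT eT sumT.
  exists (IntPart pP); first by rewrite !inE /= pv.
  by exists (head 0 q - j), m, T; split=> //=; split=> //; move: jl lh; lia.
(* [p] fixes [L] as its number of parts, then [m] and [T], hence [q] and [j]. *)
- move=> p [q j] [q' j'] [L [m [T [wT hT eT eqp [eqq hq]]]]].
  case=> L' [m' [T' [wT' hT' eT' eqp' [eqq' hq']]]].
  have eqL : L = L' by rewrite -(size_staircase L m T) -eqp eqp' size_staircase.
  subst L'; have L0 : 0 < L by apply: leq_ltn_trans hT.
  have [_ sT _] := and3P wT; have [_ sT' _] := and3P wT'.
  have [em eT2] := staircase_inj L0 sT sT' hT hT' eT eT' (etrans (esym eqp) eqp').
  have eqqq : q = q' by apply: val_inj; rewrite /= eqq eqq' em eT2.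
  by congr (_, _) => //; apply/val_inj/(@addIn L); rewrite /= -hq -hq' eqqq.
(* [(q, j)] fixes [L] as [head 0 q - j]; undoing shifts then gives [m] and [T], hence [p]. *)
- move=> p p' [q j] [L [m [T [wT hT eT eqp [eqq hq]]]]].
  case=> L' [m' [T' [wT' hT' eT' eqp' [eqq' hq']]]].
  have eqL : L = L' by apply: (@addnI j); rewrite -hq -hq'.
  subst L'; have [T0 _ _] := and3P wT; have [T0' _ _] := and3P wT'.
  have [em eT2] := iter_shift_inj T0 T0' hT hT' (etrans (esym eqq) eqq').
  by apply: val_inj; rewrite /= eqp eqp' em eT2.
Qed.
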